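(* Let $m$ be a non-negative integer and let $z\in\mathbb{C}$ with $\operatorname{Re} z>m$. Then $$\frac{2^{z-1}}{\sqrt{\pi}}\,\Gamma\!\left(\frac{z+m+1}{2}\right)\Gamma\!\left(\frac{z-m}{2}\right)=\sum_{n=0}^{m}\frac{\Gamma(z-n)}{2^n\,n!}\,(m-n+1)_{2n}.$$
   Context: $\Gamma$ denotes Euler's gamma function. $(a)_k$ denotes the Pochhammer symbol (rising factorial): $(a)_0=1$ and $(a)_k=a(a+1)\cdots(a+k-1)$ for integers $k\ge 1$. *)

(* Defs.v *)
From Stdlib Require Import Reals.
From Coquelicot Require Import Coquelicot.
Open Scope R_scope.

(* Principal complex power t^w for a real base t > 0: exp (w * ln t). *)
Definition cpow_pos (t : R) (w : C) : C :=
  (exp (Re w * ln t) * cos (Im w * ln t),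
   exp (Re w * ln t) * sin (Im w * ln t)).

(* Euler's Gamma function via its integral
   Gamma z = \int_0^\infty t^(z-1) e^(-t) dt  (meaningful for Re z > 0;
   the improper integral is the limit as a -> 0+, b -> +oo of \int_a^b). *)
Definition Gamma (z : C) : C :=
  @RInt_gen C_R_CompleteNormedModule (fun t : R => Cmult (RtoC (exp (- t))) (cpow_pos t (z - 1)%C))
           (at_right 0) (Rbar_locally p_infty).

Fixpoint pochhammer (a : R) (k : nat) : R :=
  match k with
  | O => 1
  | S k' => pochhammer a k' * (a + INR k')
  end.

(* Main.v *)
(** Both sides satisfy S_{m+2}(z) = S_m(z) + (2m+3) S_{m+1}(z-1): on the left
    this is the functional equation of Gamma, on the right the three-term
    recurrence of the Bessel polynomials, whose coefficients are
    (m-n+1)_{2n} / (2^n n!).  It remains to treat m = 0, which is Legendre's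
    duplication formula, and m = 1, which reduces to it.

    For the duplication formula, put A_n(w) = Gamma(n+w) / (n^w Gamma(n)), the
    mean of u^w when n u has the Gamma law of parameter n.  Bounding |u^w - 1| by
    [e + ((u^k - 1)^2 + (u - 1/u)^2) / e] up to a constant factor, for any e > 0,
    reduces A_n(w) -> 1 to the convergence of integer moments, which are ratios
    of factorials.  The functional equation gives
    2^(z-1) Gamma(z/2) Gamma((z+1)/2) A_{2n}(z)
      = A_n(z/2) A_n((z+1)/2) kappa_n Gamma(z)
    with kappa_n independent of z, and kappa_n -> sqrt(pi) by Wallis. *)

Require Import Defs.
From Stdlib Require Import Reals Lra Lia Factorial.
From Coquelicot Require Import Coquelicot.
Open Scope R_scope.

(** * Improper integrals over the positive half-line, with values in a normed module *)

Lemma is_RInt_gen_pair (f : R -> C) Fa Fb (FFa : Filter Fa) (FFb : Filter Fb) (l : C) :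
  is_RInt_gen (fun t => fst (f t)) Fa Fb (fst l) ->
  is_RInt_gen (fun t => snd (f t)) Fa Fb (snd l) ->
  @is_RInt_gen C_R_NormedModule f Fa Fb l.
Proof.
  intros H1 H2.
  apply filterlimi_locally. intros eps.
  apply filterlimi_locally with (eps := eps) in H1.
  apply filterlimi_locally with (eps := eps) in H2.
  generalize (filter_and _ _ H1 H2).
  apply filter_imp. intros ab [[u [Hu Bu]] [v [Hv Bv]]].
  exists (u, v). split.
  - apply (@is_RInt_fct_extend_pair R_NormedModule R_NormedModule f); assumption.
  - split; assumption.
Qed.

Lemma is_RInt_gen_fst (f : R -> C) Fa Fb (FFa : Filter Fa) (FFb : Filter Fb) (l : C) :
  @is_RInt_gen C_R_NormedModule f Fa Fb l ->
  is_RInt_gen (fun t => fst (f t)) Fa Fb (fst l).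
Proof.
  intros H.
  apply filterlimi_locally. intros eps.
  apply filterlimi_locally with (eps := eps) in H.
  revert H. apply filter_imp. intros ab [u [Hu [Bu _]]].
  exists (fst u). split; [|exact Bu].
  apply (@is_RInt_fct_extend_fst R_NormedModule R_NormedModule f); assumption.
Qed.

Lemma is_RInt_gen_snd (f : R -> C) Fa Fb (FFa : Filter Fa) (FFb : Filter Fb) (l : C) :
  @is_RInt_gen C_R_NormedModule f Fa Fb l ->
  is_RInt_gen (fun t => snd (f t)) Fa Fb (snd l).
Proof.
  intros H.
  apply filterlimi_locally. intros eps.
  apply filterlimi_locally with (eps := eps) in H.
  revert H. apply filter_imp. intros ab [u [Hu [_ Bu]]].
  exists (snd u). split; [|exact Bu].
  apply (@is_RInt_fct_extend_snd R_NormedModule R_NormedModule f); assumption.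
Qed.

(** [C_R_NormedModule] has real scalars, so a complex factor is handled through the four real
    products of its components with those of [f]. *)
Lemma is_RInt_gen_Cmult (c : C) (f : R -> C) Fa Fb (FFa : Filter Fa) (FFb : Filter Fb) (l : C) :
  @is_RInt_gen C_R_NormedModule f Fa Fb l ->
  @is_RInt_gen C_R_NormedModule (fun t => Cmult c (f t)) Fa Fb (Cmult c l).
Proof.
  intros H.
  pose proof (is_RInt_gen_fst _ _ _ _ _ _ H) as H1.
  pose proof (is_RInt_gen_snd _ _ _ _ _ _ H) as H2.
  apply is_RInt_gen_pair; try assumption; simpl.
  - apply (is_RInt_gen_minus (V := R_NormedModule)
      (fun t => fst c * fst (f t)) (fun t => snd c * snd (f t)));
    apply (is_RInt_gen_scal (V := R_NormedModule)); assumption.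
  - apply (is_RInt_gen_plus (V := R_NormedModule)
      (fun t => fst c * snd (f t)) (fun t => snd c * fst (f t)));
    apply (is_RInt_gen_scal (V := R_NormedModule)); assumption.
Qed.

Lemma filter_prod_pos :
  filter_prod (at_right 0) (Rbar_locally p_infty) (fun ab => 0 < fst ab <= snd ab).
Proof.
  apply Filter_prod with (Q := fun a => 0 < a < 1) (R := fun b => 1 < b).
  - exists (mkposreal 1 Rlt_0_1). intros y Hy H0.
    apply Rabs_lt_between' in Hy. simpl in *. lra.
  - exists 1. tauto.
  - simpl; intros; lra.
Qed.

Lemma is_RInt_gen_pos_ext {V : NormedModule R_AbsRing} (f g : R -> V) (l : V) :
  (forall t, 0 < t -> f t = g t) ->
  is_RInt_gen f (at_right 0) (Rbar_locally p_infty) l ->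
  is_RInt_gen g (at_right 0) (Rbar_locally p_infty) l.
Proof.
  intros H. apply is_RInt_gen_ext.
  generalize filter_prod_pos. apply filter_imp.
  intros ab Hab x Hx. apply H. rewrite Rmin_left in Hx; lra.
Qed.

(** The primitive is evaluated on [[a, b]] with [0 < a <= b], then both ends go to their limits. The
    integrable majorant and the functional equation of Gamma rest on this. *)
Lemma is_RInt_gen_FTC {V : CompleteNormedModule R_AbsRing} (f df : R -> V) (la lb : V) :
  (forall t, 0 < t -> is_derive f t (df t)) ->
  (forall t, 0 < t -> continuous df t) ->
  filterlim f (at_right 0) (locally la) ->
  filterlim f (Rbar_locally p_infty) (locally lb) ->
  is_RInt_gen df (at_right 0) (Rbar_locally p_infty) (minus lb la).
Proof.
  intros Hd Hc Ha Hb.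
  apply (filterlimi_lim_ext_loc (fun ab => minus (f (snd ab)) (f (fst ab)))).
  - generalize filter_prod_pos. apply filter_imp.
    intros ab Hab. apply (is_RInt_derive f df); intros x;
      rewrite Rmin_left by lra; intros Hx; [apply Hd|apply Hc]; lra.
  - unfold minus. apply (filterlim_comp_2 (G := locally lb) (H := locally (opp la))).
    + eapply filterlim_comp; [apply filterlim_snd|exact Hb].
    + eapply filterlim_comp; [eapply filterlim_comp; [apply filterlim_fst|exact Ha]|].
      apply (@filterlim_opp R_AbsRing V).
    + apply (@filterlim_plus R_AbsRing V).
Qed.

Lemma norm_RInt_le_abs {V : CompleteNormedModule R_AbsRing} (f : R -> V) (g : R -> R) c d lf lg :
  0 < c -> 0 < d ->
  (forall t, 0 < t -> norm (f t) <= g t) ->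
  is_RInt f c d lf -> is_RInt g c d lg -> norm lf <= Rabs lg.
Proof.
  intros Hc Hd Hle Hf Hg.
  destruct (Rle_dec c d) as [H|H].
  - eapply Rle_trans; [|apply Rle_abs].
    apply (norm_RInt_le f g c d); try assumption. intros; apply Hle; lra.
  - rewrite <- norm_opp, <- Rabs_Ropp. eapply Rle_trans; [|apply Rle_abs].
    apply (norm_RInt_le f g d c); try lra.
    + intros; apply Hle; lra.
    + apply is_RInt_swap; assumption.
    + apply (is_RInt_swap (V := R_NormedModule)); assumption.
Qed.

Lemma plus_minus_cancel {G : AbelianGroup} (x u y : G) :
  minus (plus (plus x u) y) u = plus x y.
Proof.
  unfold minus.
  rewrite <- !plus_assoc, (plus_comm y), (plus_assoc u), plus_opp_r, plus_zero_l.
  reflexivity.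
Qed.

(** Cauchy criterion: the integrals of [f] from [a] to [b] and from [a'] to [b'] differ by the
    pieces from [a] to [a'] and from [b] to [b'], each bounded by a difference of two integrals of
    [g], which converge. *)
Lemma ex_RInt_gen_dominated {V : CompleteNormedModule R_AbsRing} (f : R -> V) (g : R -> R) (lg : R) :
  (forall t, 0 < t -> continuous f t) ->
  (forall t, 0 < t -> norm (f t) <= g t) ->
  is_RInt_gen g (at_right 0) (Rbar_locally p_infty) lg ->
  ex_RInt_gen f (at_right 0) (Rbar_locally p_infty).
Proof.
  intros Hc Hle Hg.
  assert (Hex : forall c d, 0 < c -> 0 < d -> ex_RInt f c d).
  { intros c d H1 H2. apply ex_RInt_continuous. intros t Ht. apply Hc.
    assert (0 < Rmin c d) by (apply Rmin_glb_lt; assumption). lra. }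
  (* The integral is a relation here, so the criterion first asks that it eventually have exactly
     one value. *)
  apply (proj1 (filterlimi_locally_cauchy (U := CompleteNormedModule.CompleteSpace _ V)
     (F := filter_prod (at_right 0) (Rbar_locally p_infty))
     (fun ab => is_RInt f (fst ab) (snd ab)) ltac:(
       generalize filter_prod_pos; apply filter_imp; intros ab Hab; split;
       [apply Hex; lra|]; intros y1 y2 K1 K2;
       rewrite <- (is_RInt_unique f _ _ _ K1); exact (is_RInt_unique f _ _ _ K2)))).
  intros eps.
  (* Two integrals of [g] within [eps / 4] of [lg] differ by less than [eps / 2], and two such
     differences occur. *)
  assert (He : 0 < eps / 4) by (destruct eps; simpl; lra).
  pose proof (proj1 (filterlimi_locally _ _) Hg (mkposreal _ He)) as H.
  destruct H as [Q1 Q2 HQ1 HQ2 HQ].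
  exists (fun ab => (0 < fst ab /\ Q1 (fst ab)) /\ (0 < snd ab /\ Q2 (snd ab))). split.
  { apply Filter_prod with (Q := fun a => 0 < a /\ Q1 a) (R := fun b => 0 < b /\ Q2 b).
    - apply filter_and; [|assumption]. exists (mkposreal 1 Rlt_0_1). tauto.
    - apply filter_and; [|assumption]. exists 0. tauto.
    - simpl; tauto. }
  intros [a b] [a' b'] [[Pa Qa] [Pb Qb]] [[Pa' Qa'] [Pb' Qb']] u u' Hu Hu'; simpl in *.
  assert (D : forall x y, ball lg (eps/4) x -> ball lg (eps / 4) y -> Rabs (x - y) < eps / 2).
  { intros x y Hx Hy. change (Rabs (x - lg) < eps/4) in Hx. change (Rabs (y - lg) < eps/4) in Hy.
    apply Rabs_lt_between' in Hx. apply Rabs_lt_between' in Hy. apply Rabs_def1; lra. }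
  destruct (HQ a b Qa Qb) as [z1 [G1 B1]]. destruct (HQ a' b Qa' Qb) as [z2 [G2 B2]].
  destruct (HQ a' b' Qa' Qb') as [z3 [G3 B3]]. simpl in *.
  destruct (Hex a a' Pa Pa') as [va Hva]. destruct (Hex b b' Pb Pb') as [vb Hvb].
  assert (N1 : norm va <= Rabs (z1 - z2)).
  { apply (norm_RInt_le_abs f g a a'); try assumption.
    apply (is_RInt_Chasles (V := R_NormedModule) g a b a' z1 (opp z2) G1).
    apply (is_RInt_swap (V := R_NormedModule)). assumption. }
  assert (N2 : norm vb <= Rabs (z3 - z2)).
  { apply (norm_RInt_le_abs f g b b'); try assumption.
    replace (z3 - z2) with (plus (opp z2) z3) by (unfold plus, opp; simpl; ring).
    apply (is_RInt_Chasles (V := R_NormedModule) g b a' b'); [|assumption].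
    apply (is_RInt_swap (V := R_NormedModule)). assumption. }
  pose proof (D _ _ B1 B2). pose proof (D _ _ B3 B2).
  assert (E : u' = plus (plus (opp va) u) vb).
  { assert (K : is_RInt f a' b' (plus (plus (opp va) u) vb)).
    { apply (is_RInt_Chasles f a' b b'); [|assumption].
      apply (is_RInt_Chasles f a' a b); [|assumption]. apply is_RInt_swap; assumption. }
    rewrite <- (is_RInt_unique f _ _ _ K); symmetry; exact (is_RInt_unique f _ _ _ Hu'). }
  apply (norm_compat1 u u' eps).
  assert (E2 : minus u' u = plus (opp va) vb).
  { rewrite E. apply (plus_minus_cancel (G := NormedModule.AbelianGroup R_AbsRing V)). }
  apply Rle_lt_trans with (norm (opp va) + norm vb).
  - change (norm (minus u' u) <= norm (opp va) + norm vb). rewrite E2. apply norm_triangle.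
  - rewrite norm_opp. apply Rle_lt_trans with (Rabs (z1 - z2) + Rabs (z3 - z2)); [|lra].
    apply Rplus_le_compat; assumption.
Qed.

(** * The modulus and complex powers of a positive base *)

Lemma norm_C_R (c : C) : @norm R_AbsRing C_R_NormedModule c = Cmod c.
Proof.
  unfold Cmod. unfold norm; simpl. unfold prod_norm. f_equal.
  f_equal; [exact (pow2_abs (fst c))|exact (pow2_abs (snd c))].
Qed.

Lemma ln_le_sub1 (u : R) : 0 < u -> ln u <= u - 1.
Proof.
  intros H. pose proof (exp_ineq1_le (ln u)) as K. rewrite exp_ln in K; lra.
Qed.

Lemma cpow_pos_plus (t : R) (w1 w2 : C) :
  cpow_pos t (w1 + w2) = (cpow_pos t w1 * cpow_pos t w2)%C.
Proof.
  unfold cpow_pos, Cmult; simpl. f_equal; rewrite !Rmult_plus_distr_r, exp_plus;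
    [rewrite cos_plus|rewrite sin_plus]; unfold Re, Im; ring.
Qed.

Lemma cpow_pos_mult (s t : R) (w : C) : 0 < s -> 0 < t ->
  cpow_pos (s * t) w = (cpow_pos s w * cpow_pos t w)%C.
Proof.
  intros Hs Ht. unfold cpow_pos, Cmult; simpl. rewrite ln_mult by assumption.
  f_equal; rewrite !Rmult_plus_distr_l, exp_plus;
    [rewrite cos_plus|rewrite sin_plus]; unfold Re, Im; ring.
Qed.

Lemma cpow_pos_R (t x : R) : cpow_pos t (RtoC x) = RtoC (exp (x * ln t)).
Proof.
  unfold cpow_pos, RtoC; simpl. rewrite Rmult_0_l, cos_0, sin_0. f_equal; ring.
Qed.

Lemma cpow_pos_0 (t : R) : cpow_pos t 0 = 1.
Proof. rewrite cpow_pos_R, Rmult_0_l, exp_0. reflexivity. Qed.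

Lemma exp_INR_ln (n : nat) (t : R) : 0 < t -> exp (INR n * ln t) = t ^ n.
Proof. intros Ht. exact (Rpower_pow n t Ht). Qed.

Lemma cpow_pos_INR (t : R) (n : nat) : 0 < t -> cpow_pos t (RtoC (INR n)) = RtoC (t ^ n).
Proof. intros Ht. rewrite cpow_pos_R, exp_INR_ln; trivial. Qed.

Lemma cpow_pos_1 (t : R) : 0 < t -> cpow_pos t 1 = RtoC t.
Proof. intros Ht. rewrite cpow_pos_R, Rmult_1_l, exp_ln; trivial. Qed.

Lemma Cmod_cpow_pos (t : R) (w : C) : Cmod (cpow_pos t w) = exp (Re w * ln t).
Proof.
  unfold cpow_pos, Cmod; simpl.
  set (e := exp _). set (a := _ * ln t).
  replace (_ + _) with (e ^ 2 * ((sin a)² + (cos a)²)) by (unfold Rsqr; ring).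
  rewrite sin2_cos2, Rmult_1_r. apply sqrt_pow2. left; apply exp_pos.
Qed.

(** On the basis [(1, 0)], [(0, 1)] the curve has real coefficients, and the rule for a real
    function times a fixed vector applies. *)
Lemma is_derive_C (u v : R -> R) (t a b : R) :
  is_derive u t a -> is_derive v t b ->
  @is_derive R_AbsRing C_R_NormedModule (fun t => (u t, v t) : C) t ((a, b) : C).
Proof.
  intros Hu Hv.
  apply is_derive_ext with
    (f := fun t => plus (scal (u t) ((1, 0) : C_R_NormedModule))
                        (scal (v t) ((0, 1) : C_R_NormedModule))).
  { intros s. unfold plus, scal; simpl. unfold prod_plus, prod_scal, plus, scal; simpl.
    unfold mult; simpl. f_equal; ring. }
  replace ((a, b) : C) with (plus (scal a ((1, 0) : C_R_NormedModule))
                        (scal b ((0, 1) : C_R_NormedModule))).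
  - apply @is_derive_plus; apply @is_derive_scal_l; assumption.
  - unfold plus, scal; simpl. unfold prod_plus, prod_scal, plus, scal; simpl.
    unfold mult; simpl. f_equal; ring.
Qed.

(** * Convergence of the Gamma integral *)

Definition Gamma_integrand (z : C) (t : R) : C :=
  (RtoC (exp (- t)) * cpow_pos t (z - 1))%C.

Lemma Cmod_Gamma_integrand (z : C) (t : R) :
  Cmod (Gamma_integrand z t) = exp (- t) * exp ((Re z - 1) * ln t).
Proof.
  unfold Gamma_integrand. rewrite Cmod_mult, Cmod_R, Cmod_cpow_pos.
  rewrite Rabs_pos_eq by (left; apply exp_pos). reflexivity.
Qed.

(** Product rule for t^z e^(-t). Integrated over the half-line, it becomes the functional
    equation. *)
Lemma is_derive_Gamma_integrand (z : C) (t : R) : 0 < t ->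
  @is_derive R_AbsRing C_R_NormedModule (Gamma_integrand (z + 1)) t
    (z * Gamma_integrand z t - Gamma_integrand (z + 1) t)%C.
Proof.
  intros Ht. destruct z as [x y].
  assert (E : exp (x * ln t) = exp ((x - 1) * ln t) * t).
  { rewrite <- (exp_ln t Ht) at 3. rewrite <- exp_plus. f_equal. ring. }
  apply is_derive_ext with (f := fun t =>
    (exp (- t) * (exp (x * ln t) * cos (y * ln t)),
     exp (- t) * (exp (x * ln t) * sin (y * ln t))) : C).
  { intros s. unfold Gamma_integrand, cpow_pos, Cmult; simpl.
    replace (x + 1 + - (1)) with x by ring; replace (y + 0 + - 0) with y by ring.
    f_equal; ring. }
  replace ((x, y) * Gamma_integrand (x, y) t - Gamma_integrand ((x, y) + 1) t)%C with
   ((exp (-t) * (exp ((x-1) * ln t) * (x * cos (y * ln t) - y * sin (y * ln t)))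
    - exp (- t) * (exp (x * ln t) * cos (y * ln t)),
    exp (-t) * (exp ((x-1) * ln t) * (x * sin (y * ln t) + y * cos (y * ln t)))
    - exp (- t) * (exp (x * ln t) * sin (y * ln t))) : C).
  2: { unfold Gamma_integrand, cpow_pos, Cmult, Cminus, Cplus, Copp; simpl.
    replace (x + 1 + - (1)) with x by ring; replace (y + 0 + - 0) with y by ring.
    replace (x - 1) with (x + - (1)) by ring; replace (y + -0) with y by ring.
    f_equal; ring. }
  apply is_derive_C; auto_derive; try tauto; rewrite E; field; lra.
Qed.

Lemma continuous_Gamma_integrand (z : C) (t : R) : 0 < t ->
  @continuous R_UniformSpace C_R_NormedModule (Gamma_integrand z) t.
Proof.
  intros Ht. replace z with ((z - 1) + 1)%C by ring.
  apply (@ex_derive_continuous R_AbsRing C_R_NormedModule).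
  eexists. apply is_derive_Gamma_integrand. assumption.
Qed.

Lemma rpow_lim_0 (x : R) : 0 < x -> filterlim (fun t => exp (x * ln t)) (at_right 0) (locally 0).
Proof.
  intros Hx. eapply filterlim_comp; [|exact is_lim_exp_m].
  eapply filterlim_comp; [exact is_lim_ln_0|].
  intros P [M HM]. exists (M / x). intros y Hy. apply HM.
  apply Rmult_lt_compat_l with (r := x) in Hy; [|assumption].
  replace (x * (M / x)) with M in Hy by (field; lra). assumption.
Qed.

Lemma rpow_lim_p (x : R) : 0 < x ->
  filterlim (fun t => exp (x * ln t)) (Rbar_locally p_infty) (Rbar_locally p_infty).
Proof.
  intros Hx. eapply filterlim_comp; [|exact is_lim_exp_p].
  eapply filterlim_comp; [exact is_lim_ln_p|].
  intros P [M HM]. exists (M / x). intros y Hy. apply HM.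
  apply Rmult_lt_compat_l with (r := x) in Hy; [|assumption].
  replace (x * (M / x)) with M in Hy by (field; lra). assumption.
Qed.

(** The function -1/(1 + t^x) is the primitive of the majorant that controls the Gamma integral; its
    end values -1 and 0 give total mass 1. *)
Lemma inv_1_rpow_lim_0 (x : R) : 0 < x ->
  filterlim (fun t => - / (1 + exp (x * ln t))) (at_right 0) (locally (-1)).
Proof.
  intros Hx. eapply (filterlim_comp _ _ _ (fun t => exp (x * ln t)) (fun y => - / (1 + y)));
    [apply rpow_lim_0; assumption|].
  replace (-1) with (- / (1 + 0)) by field.
  apply (ex_derive_continuous (fun y => - / (1 + y))). auto_derive. lra.
Qed.

Lemma inv_1_rpow_lim_p (x : R) : 0 < x ->
  filterlim (fun t => - / (1 + exp (x * ln t))) (Rbar_locally p_infty) (locally 0).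
Proof.
  intros Hx. eapply (filterlim_comp _ _ _ (fun t => exp (x * ln t)) (fun y => - / (1 + y)));
    [apply rpow_lim_p; assumption|].
  apply filterlim_locally. intros [e He]. exists (/ e). intros y Hy.
  assert (0 < / e) by (apply Rinv_0_lt_compat; assumption).
  change (Rabs (- / (1 + y) - 0) < e).
  rewrite Rminus_0_r, Rabs_Ropp, Rabs_pos_eq by (left; apply Rinv_0_lt_compat; lra).
  rewrite <- (Rinv_inv e). apply Rinv_lt_contravar; [apply Rmult_lt_0_compat|]; lra.
Qed.

Lemma exp_le_compat (x y : R) : x <= y -> exp x <= exp y.
Proof. intros [H|H]; [left; apply exp_increasing; assumption|right; f_equal; assumption]. Qed.

(* With y = 2x, the inequality ln (t/y) <= t/y - 1 gives t^y <= y^y e^t. *)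
Lemma exp_rpow_bound (x : R) : 0 < x ->
  exists K, forall t, 0 < t -> exp (- t) * (1 + exp (x * ln t)) ^ 2 <= K.
Proof.
  intros Hx. set (y := 2 * x). exists (2 + 2 * exp (y * ln y)).
  intros t Ht.
  assert (Hy : 0 < y) by (unfold y; lra).
  assert (H : exp (y * ln t) <= exp (y * ln y) * exp t).
  { rewrite <- exp_plus. apply exp_le_compat.
    assert (Hl : ln (t / y) <= t / y - 1) by (apply ln_le_sub1, Rdiv_lt_0_compat; assumption).
    rewrite ln_div in Hl by assumption.
    apply Rmult_le_compat_l with (r := y) in Hl; [|lra].
    replace (y * (t / y - 1)) with (t - y) in Hl by (field; lra). lra. }
  replace (y * ln t) with (x * ln t + x * ln t) in H by (unfold y; ring).
  rewrite exp_plus in H. set (X := exp (x * ln t)) in *.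
  assert (1 <= exp t) by (pose proof (exp_ineq1_le t); lra).
  apply Rmult_le_reg_l with (exp t); [apply exp_pos|].
  rewrite <- Rmult_assoc, <- exp_plus, Rplus_opp_r, exp_0.
  (* This gives [(1 + X)^2 <= 2 + 2 X^2], hence the form of the constant; [1 <= exp t] absorbs the
     first 2. *)
  assert (0 <= (1 - X) ^ 2) by apply pow2_ge_0.
  nra.
Qed.

(** An explicit integrable function, of order t^(x-1) at 0 and t^(-x-1) at infinity. *)
Lemma is_RInt_gen_majorant (x : R) : 0 < x ->
  is_RInt_gen (fun t => x * (exp ((x - 1) * ln t) / (1 + exp (x * ln t)) ^ 2))
    (at_right 0) (Rbar_locally p_infty) 1.
Proof.
  (* The third [1] is the value of the integral; only this one becomes a difference of end
     values. *)
  intros Hx. pattern 1 at 3.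
  replace 1 with (minus 0 (-1)) by (unfold minus, plus, opp; simpl; ring). cbv beta.
  assert (P : forall t, 0 < 1 + exp (x * ln t)) by (intros t; pose proof (exp_pos (x * ln t)); lra).
  apply (is_RInt_gen_FTC (V := R_CompleteNormedModule) (fun t => - / (1 + exp (x * ln t))) _ (-1) 0).
  - intros t Ht. specialize (P t).
    assert (E : exp (x * ln t) = exp ((x - 1) * ln t) * t).
    { rewrite <- (exp_ln t Ht) at 3. rewrite <- exp_plus. f_equal. ring. }
    auto_derive; [repeat split; lra|].
    rewrite E in P |- *. field. lra.
  - intros t Ht. specialize (P t). apply (ex_derive_continuous (V := R_NormedModule)).
    auto_derive. repeat split; try lra. simpl; nra.
  - apply inv_1_rpow_lim_0; assumption.
  - apply inv_1_rpow_lim_p; assumption.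
Qed.

(** Domination: e^(-t) t^(x-1) is e^(-t) (1 + t^x)^2, bounded by [K], times the integrable t^(x-1) /
    (1 + t^x)^2. *)
Lemma is_RInt_gen_Gamma (z : C) : 0 < Re z ->
  @is_RInt_gen C_R_NormedModule (Gamma_integrand z) (at_right 0) (Rbar_locally p_infty) (Gamma z).
Proof.
  intros Hz. set (x := Re z) in *. destruct (exp_rpow_bound x Hz) as [K HK].
  apply (RInt_gen_correct (V := C_R_CompleteNormedModule)).
  apply (ex_RInt_gen_dominated (V := C_R_CompleteNormedModule)) with
   (g := fun t => scal (K / x) (x * (exp ((x - 1) * ln t) / (1 + exp (x * ln t)) ^ 2)))
   (lg := scal (K / x) 1).
  - apply continuous_Gamma_integrand.
  - intros t Ht. rewrite norm_C_R.
    change (Cmod (Gamma_integrand z t) <= K / x * (x * (exp ((x - 1) * ln t) / (1 + exp (x * ln t)) ^ 2))).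
    rewrite Cmod_Gamma_integrand. fold x.
    specialize (HK t Ht).
    pose proof (exp_pos (x * ln t)). set (X := exp (x * ln t)) in *.
    pose proof (exp_pos ((x - 1) * ln t)). set (Y := exp ((x - 1) * ln t)) in *.
    replace (K / x * (x * (Y / (1 + X) ^ 2))) with (K * (Y / (1 + X) ^ 2))
      by (field; lra).
    assert (Q : 0 < (1 + X) ^ 2) by (apply pow_lt; lra).
    replace (exp (- t) * Y) with ((exp (- t) * (1 + X) ^ 2) * (Y / (1 + X) ^ 2)) by (field; lra).
    apply Rmult_le_compat_r; [|assumption]. left; apply Rdiv_lt_0_compat; assumption.
  - apply (is_RInt_gen_scal (V := R_NormedModule)). apply is_RInt_gen_majorant; assumption.
Qed.

(** * Functional equation of Gamma and its values at positive integers *)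

Lemma continuous_Cmult_l (z : C) (f : R -> C) (t : R) :
  @continuous R_UniformSpace C_R_NormedModule f t ->
  @continuous R_UniformSpace C_R_NormedModule (fun s => z * f s)%C t.
Proof.
  intros H. apply (filterlim_locally_ball_norm (U := C_R_NormedModule)).
  intros [e He].
  pose proof (Cmod_ge_0 z) as Hz.
  (* The [+ 1] keeps the denominator positive when [z] is 0. *)
  assert (He' : 0 < e / (Cmod z + 1)) by (apply Rdiv_lt_0_compat; lra).
  apply (proj1 (filterlim_locally_ball_norm (U := C_R_NormedModule) _ _)) with
    (eps := mkposreal _ He') in H.
  revert H. apply filter_imp. intros s Hs. unfold ball_norm in *.
  rewrite norm_C_R in *. simpl in *.
  change (Cmod (z * f s - z * f t) < e). change (Cmod (f s - f t) < e / (Cmod z + 1)) in Hs.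
  replace (z * f s - z * f t)%C with (z * (f s - f t))%C by ring. rewrite Cmod_mult.
  pose proof (Cmod_ge_0 (f s - f t)).
  apply Rmult_lt_compat_l with (r := Cmod z + 1) in Hs; [|lra].
  replace ((Cmod z + 1) * (e / (Cmod z + 1))) with e in Hs by (field; lra). nra.
Qed.

Lemma filterlim_C_0 {T : Type} (F : (T -> Prop) -> Prop) (FF : Filter F) (f : T -> C) (g : T -> R) :
  F (fun t => Cmod (f t) <= g t) -> filterlim g F (locally 0) ->
  filterlim f F (@locally C_R_NormedModule (RtoC 0)).
Proof.
  intros H Hg. apply (filterlim_locally_ball_norm (U := C_R_NormedModule)).
  intros e. apply (proj1 (filterlim_locally _ _)) with (eps := e) in Hg.
  generalize (filter_and _ _ H Hg). apply filter_imp. intros t [H1 H2].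
  unfold ball_norm. rewrite norm_C_R. change (Cmod (f t - 0) < e).
  change (Rabs (g t - 0) < e) in H2. apply Rabs_def2 in H2.
  replace (f t - 0)%C with (f t) by ring. lra.
Qed.

Lemma Gamma_unique (z l : C) :
  @is_RInt_gen C_R_NormedModule (Gamma_integrand z) (at_right 0) (Rbar_locally p_infty) l ->
  Gamma z = l.
Proof.
  exact (is_RInt_gen_unique (V := C_R_CompleteNormedModule) (Gamma_integrand z) l).
Qed.

(** Integration by parts: the derivative of t^z e^(-t) has integral 0, since the boundary terms
    vanish, and subtracting it from [z * Gamma_integrand z t] leaves [Gamma_integrand (z + 1) t]. *)
Lemma Gamma_plus1 (z : C) : 0 < Re z -> Gamma (z + 1) = (z * Gamma z)%C.
Proof.
  intros Hz. set (x := Re z) in *.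
  assert (E : forall t, Cmod (Gamma_integrand (z + 1) t) = exp (- t) * exp (x * ln t)).
  { intros t. rewrite Cmod_Gamma_integrand. f_equal. f_equal. unfold x, Re; simpl. ring. }
  assert (D : @is_RInt_gen C_R_NormedModule
     (fun t => z * Gamma_integrand z t - Gamma_integrand (z + 1) t)%C
     (at_right 0) (Rbar_locally p_infty) (minus (RtoC 0 : C_R_NormedModule) (RtoC 0))).
  { apply (is_RInt_gen_FTC (V := C_R_CompleteNormedModule) (Gamma_integrand (z + 1))).
    - apply is_derive_Gamma_integrand.
    - intros t Ht. apply (continuous_minus (V := C_R_NormedModule)).
      + apply continuous_Cmult_l, continuous_Gamma_integrand, Ht.
      + apply continuous_Gamma_integrand, Ht.
    (* Near 0, e^(-t) <= 1 leaves the bound t^x. *)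
    - apply filterlim_C_0 with (g := fun t => exp (x * ln t)); [typeclasses eauto| |].
      + exists (mkposreal 1 Rlt_0_1). intros t _ Ht. rewrite E.
        pose proof (exp_pos (x * ln t)).
        assert (exp (- t) <= 1) by (rewrite <- exp_0; apply exp_le_compat; lra). nra.
      + apply rpow_lim_0; assumption.
    (* At infinity, [exp_rpow_bound] yields e^(-t) t^x <= K / (1 + t^x). *)
    - destruct (exp_rpow_bound x Hz) as [K HK].
      apply filterlim_C_0 with (g := fun t => scal (- K) (- / (1 + exp (x * ln t))));
        [typeclasses eauto| |].
      + exists 0. intros t Ht. rewrite E. specialize (HK t Ht).
        unfold scal; simpl; unfold mult; simpl.
        pose proof (exp_pos (x * ln t)). pose proof (exp_pos (- t)).
        set (X := exp (x * ln t)) in *. set (Y := exp (- t)) in *.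
        apply Rmult_le_reg_r with (1 + X); [lra|].
        replace (- K * - / (1 + X) * (1 + X)) with K by (field; lra). nra.
      + replace 0 with (scal (- K) 0) by (unfold scal; simpl; unfold mult; simpl; ring).
        eapply filterlim_comp; [apply inv_1_rpow_lim_p; assumption|].
        apply (filterlim_scal_r (V := R_NormedModule)). }
  pose proof (is_RInt_gen_Cmult z _ _ _ _ _ _ (is_RInt_gen_Gamma z Hz)) as G.
  pose proof (is_RInt_gen_minus (V := C_R_NormedModule) _ _ _ _ G D) as S.
  apply Gamma_unique.
  replace (z * Gamma z)%C with
    (minus (z * Gamma z : C_R_NormedModule) (minus (RtoC 0 : C_R_NormedModule) (RtoC 0)))%C.
  2: { change (z * Gamma z - (0 - 0) = z * Gamma z)%C. ring. }
  revert S. apply (is_RInt_gen_pos_ext (V := C_R_NormedModule)). intros t Ht.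
  change (z * Gamma_integrand z t - (z * Gamma_integrand z t - Gamma_integrand (z + 1) t)
    = Gamma_integrand (z + 1) t)%C. ring.
Qed.

Lemma Gamma_1 : Gamma 1 = 1.
Proof.
  apply Gamma_unique.
  assert (H : is_RInt_gen (fun t => exp (- t)) (at_right 0) (Rbar_locally p_infty) (minus 0 (-1))).
  { apply (is_RInt_gen_FTC (V := R_CompleteNormedModule) (fun t => - exp (- t)) _ (-1) 0).
    - intros t Ht. auto_derive; trivial. ring.
    - intros t Ht. apply (ex_derive_continuous (V := R_NormedModule)). auto_derive; trivial.
    - apply (filterlim_filter_le_1 (F := locally 0)).
      + intros P [e HP]. exists e. intros y Hy _. apply HP, Hy.
      + replace (-1) with (- exp (- 0)) by (rewrite Ropp_0, exp_0; ring).
        apply (ex_derive_continuous (V := R_NormedModule) (fun t => - exp (- t))).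
        auto_derive; trivial.
    - apply filterlim_locally. intros [e He]. exists (Rmax 0 (- ln e)). intros t Ht.
      pose proof (Rmax_l 0 (- ln e)). pose proof (Rmax_r 0 (- ln e)).
      change (Rabs (- exp (- t) - 0) < e).
      rewrite Rminus_0_r, Rabs_Ropp, Rabs_pos_eq by (left; apply exp_pos).
      rewrite <- (exp_ln e He) at 1. apply exp_increasing. lra. }
  assert (Q : forall t, 0 < t -> Gamma_integrand 1 t = RtoC (exp (- t))).
  { intros t Ht. unfold Gamma_integrand. replace (1 - 1)%C with (RtoC 0) by ring. rewrite cpow_pos_0. ring. }
  apply is_RInt_gen_pair; try typeclasses eauto.
  - replace (fst (RtoC 1)) with (minus 0 (-1)) by (unfold minus, plus, opp; simpl; ring).
    revert H. apply (is_RInt_gen_pos_ext (V := R_NormedModule)).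
    intros t Ht. rewrite Q by assumption. reflexivity.
  (* The imaginary part is presented as 0 times the same real integral, so that [H] settles it
     too. *)
  - replace (snd (RtoC 1)) with (scal 0 (minus 0 (-1))) by (unfold scal; simpl; unfold mult; simpl; ring).
    apply (is_RInt_gen_scal (V := R_NormedModule)) with (k := 0) in H; try typeclasses eauto.
    revert H. apply (is_RInt_gen_pos_ext (V := R_NormedModule)).
    intros t Ht. rewrite Q by assumption. unfold scal; simpl; unfold mult; simpl. ring.
Qed.

Lemma Gamma_fact (n : nat) : Gamma (RtoC (INR n) + 1) = RtoC (INR (fact n)).
Proof.
  induction n as [|n IH].
  - replace (RtoC (INR 0) + 1)%C with (RtoC 1) by (simpl; ring). rewrite Gamma_1. reflexivity.
  - rewrite Gamma_plus1.
    + rewrite S_INR, RtoC_plus, IH, <- RtoC_plus, <- RtoC_mult.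
      f_equal. rewrite fact_simpl, mult_INR, S_INR. reflexivity.
    + rewrite S_INR. unfold Re; simpl. pose proof (pos_INR n). lra.
Qed.

(** The real integrals behind the integer moments of the Gamma law. *)
Lemma is_RInt_gen_fact (n : nat) :
  is_RInt_gen (fun t => exp (- t) * t ^ n) (at_right 0) (Rbar_locally p_infty) (INR (fact n)).
Proof.
  assert (H : 0 < Re (RtoC (INR n) + 1)) by (unfold Re; simpl; pose proof (pos_INR n); lra).
  apply is_RInt_gen_Gamma, is_RInt_gen_fst in H; try typeclasses eauto.
  rewrite Gamma_fact in H. revert H.
  apply (is_RInt_gen_pos_ext (V := R_NormedModule)). intros t Ht.
  unfold Gamma_integrand. replace (INR n + 1 - 1)%C with (RtoC (INR n)) by ring.
  rewrite cpow_pos_INR by assumption. simpl. ring.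
Qed.

(** * Pointwise bounds on u^w - 1 *)

(** The modulus equals [2 |sin (th / 2)|], and [|sin x| <= |x|]. *)
Lemma Cmod_expi_sub1 (th : R) : Cmod ((cos th, sin th) - 1)%C <= Rabs th.
Proof.
  unfold Cmod; simpl. rewrite <- sqrt_Rsqr_abs. apply sqrt_le_1_alt.
  assert (H : cos th = 1 - 2 * sin (th / 2) * sin (th / 2)).
  { rewrite <- cos_2a_sin. f_equal. field. }
  pose proof (sin2_cos2 th) as H1. unfold Rsqr in *.
  assert (H2 : sin (th / 2) * sin (th / 2) <= th / 2 * (th / 2)).
  { assert (P : forall x, 0 <= x -> Rabs (sin x) <= x).
    { intros x [Hx|<-]; [|rewrite sin_0, Rabs_R0; lra].
      apply Rabs_le. split; [|left; apply sin_lt_x, Hx].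
      destruct (Rle_dec x PI) as [Hp|Hp].
      - pose proof (sin_ge_0 x). lra.
      - pose proof (SIN_bound x). pose proof PI2_1. lra. }
    apply Rsqr_le_abs_1. destruct (Rle_dec 0 (th / 2)) as [Hp|Hp].
    - rewrite (Rabs_pos_eq (th / 2)) by assumption. apply P, Hp.
    - rewrite (Rabs_left (th / 2)), <- Rabs_Ropp, <- sin_neg by lra. apply P; lra. }
  nra.
Qed.

(** Trades the logarithm for a rational function, whose square involves integer powers of [u] only.
    It follows from [ln v <= v - 1] at [v = u] and at [v = 1 / u]. *)
Lemma Rabs_ln_le (u : R) : 0 < u -> Rabs (ln u) <= Rabs (u - / u).
Proof.
  intros Hu. pose proof (ln_le_sub1 u Hu) as H1.
  pose proof (Rinv_0_lt_compat u Hu) as Hi.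
  pose proof (ln_le_sub1 (/ u) Hi) as H2. rewrite ln_Rinv in H2 by assumption.
  assert (E : u * / u = 1) by (field; lra).
  destruct (Rle_dec 1 u) as [H|H].
  - assert (/ u <= 1) by nra. rewrite (Rabs_pos_eq (u - / u)) by lra. apply Rabs_le. lra.
  - assert (1 < / u) by nra. rewrite (Rabs_left (u - / u)) by lra. apply Rabs_le. lra.
Qed.

(** On either side of [u = 1], u^a lies between 1 and u^k; a real exponent is traded for an integer
    one. *)
Lemma Rabs_rpow_sub1_le (u a : R) (k : nat) : 0 < u -> 0 <= a <= INR k ->
  Rabs (exp (a * ln u) - 1) <= Rabs (u ^ k - 1).
Proof.
  intros Hu Ha. rewrite <- (exp_INR_ln k u Hu).
  destruct (Rle_dec 0 (ln u)) as [H|H].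
  - assert (1 <= exp (a * ln u)) by (rewrite <- exp_0; apply exp_le_compat; nra).
    assert (exp (a * ln u) <= exp (INR k * ln u)) by (apply exp_le_compat; nra).
    rewrite !Rabs_pos_eq; lra.
  - assert (exp (a * ln u) <= 1) by (rewrite <- exp_0; apply exp_le_compat; nra).
    assert (exp (INR k * ln u) <= exp (a * ln u)) by (apply exp_le_compat; nra).
    rewrite !Rabs_left1; lra.
Qed.

(** Trades an absolute value for a square, whose mean is a combination of integer moments. *)
Lemma Rabs_le_eps_sqr (y e : R) : 0 < e -> Rabs y <= e + y ^ 2 / e.
Proof.
  intros He. rewrite <- pow2_abs. set (x := Rabs y).
  apply Rmult_le_reg_r with e; [assumption|].
  replace ((e + x ^ 2 / e) * e) with (e ^ 2 + x ^ 2) by (field; lra).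
  assert (0 <= (x - e) ^ 2) by apply pow2_ge_0.
  assert (0 <= x) by apply Rabs_pos. nra.
Qed.

(** With u^w = X e^(i th), the difference splits into a radial part (X - 1) e^(i th), bounded by
    |u^k - 1|, and an angular part e^(i th) - 1, bounded by |Im w| |u - 1/u|. *)
Lemma Cmod_cpow_pos_sub1_le (u : R) (w : C) (k : nat) (e : R) :
  0 < u -> 0 <= Re w <= INR k -> 0 < e ->
  Cmod (cpow_pos u w - 1)%C <=
    (1 + Rabs (Im w)) * (e + ((u ^ k - 1) ^ 2 + (u - / u) ^ 2) / e).
Proof.
  intros Hu Hw He. set (X := exp (Re w * ln u)). set (th := Im w * ln u).
  set (P := u ^ k - 1). set (Q := u - / u). set (b := Rabs (Im w)).
  assert (Hb : 0 <= b) by apply Rabs_pos.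
  assert (E : (cpow_pos u w - 1 = RtoC (X - 1) * (cos th, sin th) + ((cos th, sin th) - 1))%C).
  { unfold cpow_pos, Cminus, Cplus, Cmult, Copp, RtoC; simpl.
    fold X. fold th. f_equal; ring. }
  rewrite E. eapply Rle_trans; [apply Cmod_triangle|].
  assert (H1 : Cmod (RtoC (X - 1) * (cos th, sin th))%C <= Rabs P).
  { rewrite Cmod_mult, Cmod_R.
    replace (Cmod (cos th, sin th)) with 1.
    - rewrite Rmult_1_r. apply Rabs_rpow_sub1_le; assumption.
    - unfold Cmod; simpl. pose proof (sin2_cos2 th) as H. unfold Rsqr in H.
      replace (_ + _) with 1 by lra. rewrite sqrt_1. reflexivity. }
  assert (H2 : Cmod ((cos th, sin th) - 1)%C <= b * Rabs Q).
  { eapply Rle_trans; [apply Cmod_expi_sub1|]. unfold th. rewrite Rabs_mult.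
    apply Rmult_le_compat_l; [assumption|]. apply Rabs_ln_le, Hu. }
  pose proof (Rabs_le_eps_sqr P e He) as H3. pose proof (Rabs_le_eps_sqr Q e He) as H4.
  assert (0 <= P ^ 2 / e) by (apply Rdiv_le_0_compat; [apply pow2_ge_0|assumption]).
  assert (0 <= Q ^ 2 / e) by (apply Rdiv_le_0_compat; [apply pow2_ge_0|assumption]).
  replace ((P ^ 2 + Q ^ 2) / e) with (P ^ 2 / e + Q ^ 2 / e) by (field; lra).
  assert (b * Rabs Q <= b * (e + Q ^ 2 / e)) by (apply Rmult_le_compat_l; assumption).
  assert (0 <= b * (P ^ 2 / e)) by (apply Rmult_le_pos; assumption).
  nra.
Qed.

(** * Concentration of the Gamma law and the limit of A_n(w) *)

(* The j-th moment of u = t/(m+3) when t has the Gamma law of parameter m+3. *)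
Definition fact_ratio (m j : nat) : R :=
  INR (fact (m + 2 + j)) / (INR (fact (m + 2)) * (INR m + 3) ^ j).

(* The mean of (u^k - 1)^2 + (u - 1/u)^2 under the same law; the shift by 3 makes
   the moment of order -2 finite. *)
Definition second_moments (k m : nat) : R :=
  fact_ratio m (2 * k) - 2 * fact_ratio m k + fact_ratio m 2
    + (INR m + 3) ^ 2 / ((INR m + 1) * (INR m + 2)) - 1.

(* A_n(w) with n = m + 3. *)
Definition Gamma_ratio (w : C) (m : nat) : C :=
  (Gamma (RtoC (INR m + 3) + w) / (cpow_pos (INR m + 3) w * RtoC (INR (fact (m + 2)))))%C.

Lemma cpow_pos_neq_0 (t : R) (w : C) : cpow_pos t w <> 0.
Proof.
  apply Cmod_gt_0. rewrite Cmod_cpow_pos. apply exp_pos.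
Qed.

Lemma RtoC_fact_neq_0 (n : nat) : RtoC (INR (fact n)) <> 0.
Proof. intros H. apply RtoC_inj in H. revert H. apply INR_fact_neq_0. Qed.

(** The pointwise bound at [u = t / (m + 3)] is integrated against t^(m+2) e^(-t), of mass
    (m+2)!. *)
Lemma Gamma_ratio_bound (w : C) (k m : nat) (e : R) :
  0 <= Re w <= INR k -> 0 < e ->
  Cmod (Gamma_ratio w m - 1)%C <= (1 + Rabs (Im w)) * (e + second_moments k m / e).
Proof.
  intros Hw He. set (B := 1 + Rabs (Im w)).
  set (s := INR m + 3). set (F := INR (fact (m + 2))).
  assert (Hm : 0 <= INR m) by apply pos_INR.
  assert (Hs : 0 < s) by (unfold s; lra).
  assert (HF : 0 < F) by apply INR_fact_lt_0.
  set (sa := exp (Re w * ln s)). assert (Hsa : 0 < sa) by apply exp_pos.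
  (* Since [s - 1] is the integer [m + 2], the value of Gamma at [s] is the factorial [F]. *)
  assert (Es : (RtoC s = RtoC (INR (m + 2)) + 1)%C).
  { rewrite <- RtoC_plus. f_equal. unfold s. rewrite plus_INR. simpl. ring. }
  assert (I1 : @is_RInt_gen C_R_NormedModule
     (fun t => Gamma_integrand (RtoC s + w) t - cpow_pos s w * Gamma_integrand (RtoC s) t)%C
     (at_right 0) (Rbar_locally p_infty)
     (Gamma (RtoC s + w) - cpow_pos s w * RtoC F)%C).
  { apply (is_RInt_gen_minus (V := C_R_NormedModule)).
    - apply is_RInt_gen_Gamma. unfold Re in *; simpl. lra.
    - apply is_RInt_gen_Cmult; try typeclasses eauto.
      unfold F. rewrite <- Gamma_fact, <- Es. apply is_RInt_gen_Gamma. exact Hs. }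
  set (J := fun n t => exp (- t) * t ^ n).
  (* The bound at [u = t / s], times [sa] and t^(m+2) e^(-t), expanded in powers of [t]: the
     constant terms 1 and -2 of the two squares give [- / e], and u^(-2) lowers the power to t^m. *)
  set (g := fun t => sa * B * (e - / e) * J (m + 2)%nat t
     + (sa * B / e / s ^ (2 * k) * J (m + 2 + 2 * k)%nat t
        + - 2 * sa * B / e / s ^ k * J (m + 2 + k)%nat t
        + (sa * B / e / s ^ 2 * J (m + 2 + 2)%nat t + sa * B / e * s ^ 2 * J m t))).
  assert (I2 : is_RInt_gen (V := R_NormedModule) g (at_right 0) (Rbar_locally p_infty)
    (sa * B * (e - / e) * F
     + (sa * B / e / s ^ (2 * k) * INR (fact (m + 2 + 2 * k))
        + - 2 * sa * B / e / s ^ k * INR (fact (m + 2 + k))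
        + (sa * B / e / s ^ 2 * INR (fact (m + 2 + 2)) + sa * B / e * s ^ 2 * INR (fact m))))).
  { assert (JS : forall c n, is_RInt_gen (V := R_NormedModule) (fun t => c * J n t)
      (at_right 0) (Rbar_locally p_infty) (c * INR (fact n))).
    { intros c n. exact (is_RInt_gen_scal (V := R_NormedModule) _ c _ (is_RInt_gen_fact n)). }
    assert (JP : forall (f1 f2 : R -> R) (l1 l2 : R),
      is_RInt_gen (V := R_NormedModule) f1 (at_right 0) (Rbar_locally p_infty) l1 ->
      is_RInt_gen (V := R_NormedModule) f2 (at_right 0) (Rbar_locally p_infty) l2 ->
      is_RInt_gen (V := R_NormedModule) (fun t => f1 t + f2 t) (at_right 0)
        (Rbar_locally p_infty) (l1 + l2)).
    { intros f1 f2 l1 l2. exact (is_RInt_gen_plus (V := R_NormedModule) f1 f2 l1 l2). }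
    unfold g, F. apply JP; [apply JS|]. apply JP; apply JP; apply JS. }
  assert (N : Cmod (Gamma (RtoC s + w) - cpow_pos s w * RtoC F)%C <= F * sa * B * (e + second_moments k m / e)).
  { rewrite <- norm_C_R.
    match type of I2 with is_RInt_gen _ _ _ ?l => replace (F * sa * B * (e + second_moments k m / e)) with l end.
    - apply (RInt_gen_norm (V := C_R_CompleteNormedModule) _ g _ _) with (3 := I1) (4 := I2).
      + generalize filter_prod_pos. apply filter_imp. intros ab; lra.
      + generalize filter_prod_pos. apply filter_imp. intros ab Hab t Ht'.
        assert (Ht : 0 < t) by lra. clear Ht' Hab ab.
        rewrite norm_C_R. unfold Gamma_integrand.
        assert (Hu : 0 < t / s) by (apply Rdiv_lt_0_compat; assumption).
        replace (RtoC s + w - 1)%C with (RtoC (INR (m + 2)) + w)%C by (rewrite Es; ring).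
        replace (RtoC s - 1)%C with (RtoC (INR (m + 2)))%C by (rewrite Es; ring).
        rewrite cpow_pos_plus, cpow_pos_INR by assumption.
        replace (cpow_pos t w) with (cpow_pos s w * cpow_pos (t / s) w)%C
          by (rewrite <- cpow_pos_mult by assumption; f_equal; field; lra).
        match goal with |- Cmod ?c <= _ => replace c with
          (RtoC (exp (- t) * t ^ (m + 2)) * (cpow_pos s w * (cpow_pos (t / s) w - 1)))%C
          by (rewrite RtoC_mult; ring) end.
        rewrite !Cmod_mult, Cmod_R, Cmod_cpow_pos. fold sa.
        pose proof (exp_pos (- t)) as He1.
        pose proof (pow_lt t (m + 2) Ht) as He2.
        rewrite Rabs_pos_eq by (left; apply Rmult_lt_0_compat; assumption).
        eapply Rle_trans.
        { apply Rmult_le_compat_l; [left; apply Rmult_lt_0_compat; assumption|].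
          apply Rmult_le_compat_l; [left; assumption|].
          apply (Cmod_cpow_pos_sub1_le (t / s) w k e Hu Hw He). }
        right. unfold g, J. set (E := exp (- t)). set (u := t / s) in *.
        replace t with (u * s) by (unfold u; field; lra).
        fold B.
        replace (2 * k)%nat with (k + k)%nat by lia.
        rewrite !pow_add, !Rpow_mult_distr. field.
        repeat split; try lra. apply pow_nonzero. lra.
    - unfold second_moments, fact_ratio. fold s. fold F.
      (* Turns the moment of order -2, which is s^2 m! / (m+2)!, into the rational term of
         [second_moments]. *)
      assert (EF : F = (INR m + 2) * (INR m + 1) * INR (fact m)).
      { unfold F. replace (m + 2)%nat with (S (S m)) by lia.
        rewrite !fact_simpl, !mult_INR, !S_INR. ring. }
      pose proof (INR_fact_lt_0 m). rewrite EF.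
      replace (2 * k)%nat with (k + k)%nat by lia. rewrite !pow_add.
      field. repeat split; try lra. apply pow_nonzero. lra. }
  assert (Hc : cpow_pos s w <> 0) by apply cpow_pos_neq_0.
  assert (HF' : RtoC F <> 0) by apply RtoC_fact_neq_0.
  apply Rmult_le_reg_l with (F * sa); [apply Rmult_lt_0_compat; assumption|].
  replace (F * sa * (B * (e + second_moments k m / e)))
    with (F * sa * B * (e + second_moments k m / e)) by ring.
  eapply Rle_trans; [|exact N]. right.
  replace (F * sa) with (Cmod (cpow_pos s w * RtoC F)).
  - rewrite <- Cmod_mult. f_equal. unfold Gamma_ratio. fold s. fold F. field. split; assumption.
  - rewrite Cmod_mult, Cmod_R, Cmod_cpow_pos, Rabs_pos_eq by lra. fold sa. ring.
Qed.

Lemma is_lim_seq_frac (a b c d : R) :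
  is_lim_seq (fun m => (INR m + a) * (INR m + b) / ((INR m + c) * (INR m + d))) 1.
Proof.
  assert (L : forall a, is_lim_seq (fun m => a * / (INR m)) 0).
  { intros x. replace (Finite 0) with (Rbar_mult x 0) by (simpl; f_equal; ring).
    apply is_lim_seq_scal_l. replace (Finite 0) with (Rbar_inv p_infty) by reflexivity.
    apply is_lim_seq_inv; [apply is_lim_seq_INR|discriminate]. }
  assert (L1 : forall a, is_lim_seq (fun m => 1 + a * / (INR m)) 1).
  { intros x. pose proof (is_lim_seq_plus' _ _ _ _ (is_lim_seq_const 1) (L x)) as H.
    rewrite Rplus_0_r in H. exact H. }
  pose proof (is_lim_seq_div' _ _ _ _
    (is_lim_seq_mult' _ _ _ _ (L1 a) (L1 b)) (is_lim_seq_mult' _ _ _ _ (L1 c) (L1 d))) as H.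
  replace (1 * 1 / (1 * 1)) with 1 in H by field.
  specialize (H ltac:(lra)). revert H. apply is_lim_seq_ext_loc.
  exists 1%nat. intros n Hn. apply lt_0_INR in Hn.
  replace (1 + a * / INR n) with ((INR n + a) / INR n) by (field; lra).
  replace (1 + b * / INR n) with ((INR n + b) / INR n) by (field; lra).
  replace (1 + c * / INR n) with ((INR n + c) / INR n) by (field; lra).
  replace (1 + d * / INR n) with ((INR n + d) / INR n) by (field; lra).
  unfold Rdiv. rewrite !Rinv_mult, !Rinv_inv.
  generalize (/ (INR n + c)) (/ (INR n + d)). intros x y. field. lra.
Qed.

(** Passing from [j] to [j + 1] multiplies the moment by [(m + j + 3) / (m + 3)], which tends to
    1. *)
Lemma fact_ratio_lim (j : nat) : is_lim_seq (fun m => fact_ratio m j) 1.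
Proof.
  induction j as [|j IH].
  - apply is_lim_seq_ext with (fun _ => 1); [|apply is_lim_seq_const].
    intros m. unfold fact_ratio. rewrite Nat.add_0_r. simpl. field. apply INR_fact_neq_0.
  (* The two shifts 0 insert a factor [m / m] to fit the shape of [is_lim_seq_frac]; hence the
     restriction to [m >= 1] below. *)
  - pose proof (is_lim_seq_mult' _ _ _ _ IH (is_lim_seq_frac (INR j + 3) 0 3 0)) as H.
    rewrite Rmult_1_l in H. revert H. apply is_lim_seq_ext_loc.
    exists 1%nat. intros m Hm. apply lt_0_INR in Hm. unfold fact_ratio.
    replace (m + 2 + S j)%nat with (S (m + 2 + j)) by lia.
    rewrite fact_simpl, mult_INR, S_INR, !plus_INR. simpl pow. simpl (INR 2). field.
    repeat split; try lra; [apply pow_nonzero; lra|apply INR_fact_neq_0].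
Qed.

Lemma second_moments_lim (k : nat) : is_lim_seq (second_moments k) 0.
Proof.
  pose proof (is_lim_seq_frac 3 3 1 2) as H0.
  pose proof (is_lim_seq_scal_l _ 2 _ (fact_ratio_lim k)) as H1.
  simpl in H1.
  pose proof (is_lim_seq_minus' _ _ _ _ (fact_ratio_lim (2 * k)) H1) as H2.
  pose proof (is_lim_seq_plus' _ _ _ _ H2 (fact_ratio_lim 2)) as H3.
  pose proof (is_lim_seq_plus' _ _ _ _ H3 H0) as H4.
  pose proof (is_lim_seq_minus' _ _ _ _ H4 (is_lim_seq_const 1)) as H5.
  replace (1 - 2 * 1 + 1 + 1 - 1) with 0 in H5 by ring.
  revert H5. apply is_lim_seq_ext. intros m. unfold second_moments. f_equal. f_equal.
  f_equal. ring.
Qed.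

Lemma Gamma_ratio_lim (w : C) : 0 <= Re w ->
  is_lim_seq (fun m => Cmod (Gamma_ratio w m - 1)%C) 0.
Proof.
  intros Hw. destruct (nfloor_ex (Re w) Hw) as [n [_ Hn]].
  assert (Hk : 0 <= Re w <= INR (S n)) by (rewrite S_INR; lra).
  apply is_lim_seq_spec. intros [e He]. simpl.
  set (B := 1 + Rabs (Im w)).
  assert (HB : 0 < B) by (unfold B; pose proof (Rabs_pos (Im w)); lra).
  (* With [d] as the free parameter of the bound and second moments below [d * d], the total stays
     under [B * (d + d) = e / 2]. *)
  set (d := e / (4 * B)). assert (Hd : 0 < d) by (apply Rdiv_lt_0_compat; lra).
  pose proof (second_moments_lim (S n)) as L. apply is_lim_seq_spec in L.
  destruct (L (mkposreal _ (Rmult_lt_0_compat _ _ Hd Hd))) as [N HN]. exists N.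
  intros m Hm. specialize (HN m Hm). simpl in HN. rewrite Rminus_0_r in *.
  apply Rabs_def2 in HN. rewrite Rabs_pos_eq by apply Cmod_ge_0.
  eapply Rle_lt_trans; [apply (Gamma_ratio_bound w (S n) m d Hk Hd)|]. fold B.
  assert (second_moments (S n) m / d < d).
  { apply Rmult_lt_reg_r with d; [assumption|]. unfold Rdiv.
    rewrite Rmult_assoc, Rinv_l by lra. lra. }
  apply Rlt_trans with (B * (d + d)).
  - apply Rmult_lt_compat_l; lra.
  - unfold d. replace (B * (e / (4 * B) + e / (4 * B))) with (e / 2) by (field; lra). lra.
Qed.

Lemma Cmod_mult_sub1_lim (f g : nat -> C) :
  is_lim_seq (fun m => Cmod (f m - 1)%C) 0 -> is_lim_seq (fun m => Cmod (g m - 1)%C) 0 ->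
  is_lim_seq (fun m => Cmod (f m * g m - 1)%C) 0.
Proof.
  intros Hf Hg.
  pose proof (is_lim_seq_plus' _ _ _ _ (is_lim_seq_mult' _ _ _ _ Hf Hg)
    (is_lim_seq_plus' _ _ _ _ Hf Hg)) as H.
  replace (0 * 0 + (0 + 0)) with 0 in H by ring.
  apply (is_lim_seq_le_le (fun _ => 0) _ _ _) with (3 := H); [|apply is_lim_seq_const].
  intros m. split; [apply Cmod_ge_0|].
  replace (f m * g m - 1)%C with ((f m - 1) * (g m - 1) + ((f m - 1) + (g m - 1)))%C by ring.
  eapply Rle_trans; [apply Cmod_triangle|]. rewrite Cmod_mult.
  apply Rplus_le_compat_l, Cmod_triangle.
Qed.

(** * Wallis integrals and the limit of kappa_n *)

Definition wallis_int (n : nat) : R := RInt (fun x => sin x ^ n) 0 (PI / 2).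

Lemma is_RInt_wallis (n : nat) :
  is_RInt (fun x => sin x ^ n) 0 (PI / 2) (wallis_int n).
Proof.
  apply (RInt_correct (V := R_CompleteNormedModule)).
  apply (ex_RInt_continuous (V := R_CompleteNormedModule)). intros x _.
  apply (ex_derive_continuous (V := R_NormedModule)). auto_derive. trivial.
Qed.

(** Integrates the derivative of sin^(n+1) cos, a function that vanishes at 0 and at [PI / 2]. *)
Lemma wallis_rec (n : nat) : (INR n + 2) * wallis_int (S (S n)) = (INR n + 1) * wallis_int n.
Proof.
  assert (H : is_RInt (fun x => (INR n + 1) * sin x ^ n - (INR n + 2) * sin x ^ (S (S n)))
     0 (PI / 2) (minus (sin (PI / 2) ^ (S n) * cos (PI / 2)) (sin 0 ^ (S n) * cos 0))).
  { apply (is_RInt_derive (V := R_CompleteNormedModule) (fun x => sin x ^ (S n) * cos x)).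
    - intros x _. auto_derive; trivial.
      change (1 * cos x * (INR (S n) * sin x ^ n) * cos x + sin x ^ S n * (1 * - sin x) =
        (INR n + 1) * sin x ^ n - (INR n + 2) * sin x ^ S (S n)).
      rewrite S_INR.
      replace (sin x ^ S n) with (sin x * sin x ^ n) by reflexivity.
      replace (sin x ^ S (S n)) with (sin x * sin x * sin x ^ n) by (simpl; ring).
      pose proof (sin2_cos2 x) as K. unfold Rsqr in K.
      transitivity ((INR n + 1) * sin x ^ n * (sin x * sin x + cos x * cos x)
        - (INR n + 2) * (sin x * sin x * sin x ^ n)); [ring|rewrite K; ring].
    - intros x _. apply (ex_derive_continuous (V := R_NormedModule)). auto_derive. trivial. }
  pose proof (is_RInt_minus (V := R_NormedModule) _ _ _ _ _ _
   (is_RInt_scal (V := R_NormedModule) _ _ _ (INR n + 1) _ (is_RInt_wallis n))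
   (is_RInt_scal (V := R_NormedModule) _ _ _ (INR n + 2) _ (is_RInt_wallis (S (S n))))) as H2.
  apply (is_RInt_unique (V := R_CompleteNormedModule)) in H.
  apply (is_RInt_unique (V := R_CompleteNormedModule)) in H2.
  pose proof (eq_trans (eq_sym H) H2) as E. rewrite cos_PI2, sin_0 in E.
  unfold minus, plus, opp, scal in E; simpl in E. unfold mult in E; simpl in E.
  lra.
Qed.

Lemma wallis_decr (n : nat) : wallis_int (S n) <= wallis_int n.
Proof.
  pose proof PI_RGT_0.
  apply (is_RInt_le (fun x => sin x ^ S n) (fun x => sin x ^ n) 0 (PI / 2));
    [lra|apply is_RInt_wallis|apply is_RInt_wallis|].
  intros x Hx. simpl.
  assert (0 <= sin x) by (apply sin_ge_0; lra). pose proof (SIN_bound x).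
  pose proof (pow_le (sin x) n H0). nra.
Qed.

Lemma wallis_0 : wallis_int 0 = PI / 2.
Proof.
  unfold wallis_int. simpl. rewrite (RInt_const (V := R_CompleteNormedModule)).
  unfold scal; simpl; unfold mult; simpl. ring.
Qed.

Lemma wallis_1 : wallis_int 1 = 1.
Proof.
  transitivity (minus (- cos (PI / 2)) (- cos 0)).
  2: { rewrite cos_PI2, cos_0; unfold minus, plus, opp; simpl; ring. }
  apply (is_RInt_unique (V := R_CompleteNormedModule)).
  apply (is_RInt_derive (V := R_CompleteNormedModule) (fun x => - cos x)).
  - intros x _. auto_derive; trivial. ring.
  - intros x _. apply (ex_derive_continuous (V := R_NormedModule)). auto_derive. trivial.
Qed.

(** By the recurrence the left side does not depend on [n]; at [n = 0] it is [PI / 2]. *)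
Lemma wallis_mult (n : nat) : wallis_int n * wallis_int (S n) * (INR n + 1) = PI / 2.
Proof.
  induction n as [|n IH].
  - rewrite wallis_0, wallis_1. simpl. ring.
  - pose proof (wallis_rec n). rewrite S_INR. rewrite <- IH.
    replace (INR n + 1 + 1) with (INR n + 2) by ring.
    replace (wallis_int (S n) * wallis_int (S (S n)) * (INR n + 2))
     with (wallis_int (S n) * ((INR n + 2) * wallis_int (S (S n)))) by ring.
    rewrite H. ring.
Qed.

Lemma wallis_odd (n : nat) :
  wallis_int (2 * n + 1) * INR (fact (2 * n + 1)) = 4 ^ n * INR (fact n) ^ 2.
Proof.
  induction n as [|n IH].
  - simpl. rewrite wallis_1. ring.
  - pose proof (wallis_rec (2 * n + 1)) as H.
    replace (2 * S n + 1)%nat with (S (S (2 * n + 1))) by lia.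
    rewrite !fact_simpl, !mult_INR, !S_INR. simpl pow.
    rewrite plus_INR, mult_INR in H |- *. change (INR 2) with 2 in *. change (INR 1) with 1 in *.
    simpl pow in IH.
    transitivity ((2 * INR n + 1 + 1) * (2 * INR n + 1 + 1) *
      (wallis_int (2 * n + 1) * INR (fact (2 * n + 1)))); [|rewrite IH; ring].
    transitivity ((2 * INR n + 1 + 1) * INR (fact (2 * n + 1)) *
      ((2 * INR n + 1 + 2) * wallis_int (S (S (2 * n + 1))))); [ring|].
    rewrite H. ring.
Qed.

(* kappa_n for n = m + 3; it equals 2 sqrt(n) W_{2n-1}, with W the Wallis integral. *)
Definition wallis_const (m : nat) : R :=
  sqrt (INR m + 3) * INR (fact (m + 2)) ^ 2 * 4 ^ (m + 3) / (2 * INR (fact (2 * m + 5))).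

(** Put n = m + 3. As W decreases, W_(2n-1)^2 lies between W_(2n-1) W_(2n) = PI/(4n) and W_(2n-2)
    W_(2n-1) = PI/(4n-2). The repeated factor [INR m + 3] in the upper bound fits
    [is_lim_seq_frac]. *)
Lemma wallis_const_sqr_bounds (m : nat) :
  PI <= wallis_const m ^ 2 <= PI * ((INR m + 3) * (INR m + 3) / ((INR m + 5 / 2) * (INR m + 3))).
Proof.
  assert (Hm : 0 <= INR m) by apply pos_INR.
  pose proof (wallis_odd (m + 2)) as HO.
  pose proof (wallis_mult (2 * (m + 2) + 1)) as HM.
  pose proof (wallis_mult (2 * (m + 2))) as HM2.
  pose proof (wallis_decr (2 * (m + 2) + 1)) as D1.
  pose proof (wallis_decr (2 * (m + 2))) as D2.
  replace (S (2 * (m + 2))) with (2 * (m + 2) + 1)%nat in * by lia.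
  set (W := wallis_int (2 * (m + 2) + 1)) in *.
  rewrite !plus_INR, !mult_INR, !plus_INR in HM.
  rewrite !mult_INR, !plus_INR in HM2. change (INR 2) with 2 in *. change (INR 1) with 1 in *.
  assert (E : wallis_const m = 2 * sqrt (INR m + 3) * W).
  { unfold wallis_const. replace (m + 3)%nat with (S (m + 2)) by lia.
    replace (2 * m + 5)%nat with (2 * (m + 2) + 1)%nat by lia.
    pose proof (INR_fact_neq_0 (2 * (m + 2) + 1)).
    simpl pow at 2. apply Rmult_eq_reg_r with (INR (fact (2 * (m + 2) + 1))); [|assumption].
    replace (2 * sqrt (INR m + 3) * W * INR (fact (2 * (m + 2) + 1))) with
      (2 * sqrt (INR m + 3) * (W * INR (fact (2 * (m + 2) + 1)))) by ring.
    rewrite HO. field. assumption. }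
  assert (E2 : wallis_const m ^ 2 = 4 * (INR m + 3) * W ^ 2).
  { rewrite E. replace ((2 * sqrt (INR m + 3) * W) ^ 2) with
      (4 * (sqrt (INR m + 3) * sqrt (INR m + 3)) * W ^ 2) by ring.
    rewrite sqrt_sqrt by lra. ring. }
  rewrite E2.
  assert (HW : 0 < W).
  { pose proof (INR_fact_lt_0 (2 * (m + 2) + 1)). pose proof (INR_fact_lt_0 (m + 2)).
    assert (0 < 4 ^ (m + 2)) by (apply pow_lt; lra).
    assert (0 < INR (fact (m + 2)) ^ 2) by (apply pow_lt; assumption).
    apply Rmult_lt_reg_r with (INR (fact (2 * (m + 2) + 1))); [assumption|].
    rewrite HO, Rmult_0_l. apply Rmult_lt_0_compat; assumption. }
  set (W1 := wallis_int (S (2 * (m + 2) + 1))) in *.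
  set (W0 := wallis_int (2 * (m + 2))) in *.
  split.
  - assert (W * W1 <= W ^ 2) by (simpl; nra). nra.
  - replace (PI * ((INR m + 3) * (INR m + 3) / ((INR m + 5 / 2) * (INR m + 3)))) with
     (4 * (INR m + 3) * (PI / 2 / (2 * (INR m + 2) + 1))) by (field; lra).
    apply Rmult_le_compat_l; [lra|].
    apply Rmult_le_reg_r with (2 * (INR m + 2) + 1); [lra|].
    replace (PI / 2 / (2 * (INR m + 2) + 1) * (2 * (INR m + 2) + 1)) with (PI / 2) by (field; lra).
    rewrite <- HM2. apply Rmult_le_compat_r; [lra|]. simpl; nra.
Qed.

Lemma wallis_const_lim : is_lim_seq wallis_const (sqrt PI).
Proof.
  assert (H : is_lim_seq (fun m => wallis_const m ^ 2) PI).
  { apply (is_lim_seq_le_le (fun _ => PI) _ _ _ wallis_const_sqr_bounds).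
    - apply is_lim_seq_const.
    - pose proof (is_lim_seq_scal_l _ PI _ (is_lim_seq_frac 3 3 (5/2) 3)) as K.
      simpl in K. rewrite Rmult_1_r in K. exact K. }
  apply (is_lim_seq_continuous sqrt) in H.
  - revert H. apply is_lim_seq_ext. intros m. apply sqrt_pow2.
    unfold wallis_const. apply Rdiv_le_0_compat.
    + apply Rmult_le_pos; [apply Rmult_le_pos; [apply sqrt_pos|apply pow2_ge_0]|apply pow_le; lra].
    + pose proof (INR_fact_lt_0 (2 * m + 5)). lra.
  - apply continuity_pt_sqrt. left. apply PI_RGT_0.
Qed.

(** * Legendre's duplication formula *)

Fixpoint Cpochhammer (z : C) (n : nat) : C :=
  match n with
  | O => 1
  | S k => Cpochhammer z k * (RtoC (INR k) + z)
  end%C.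

Lemma Gamma_INR_plus (z : C) (n : nat) : 0 < Re z ->
  Gamma (RtoC (INR n) + z) = (Cpochhammer z n * Gamma z)%C.
Proof.
  intros Hz. induction n as [|n IH].
  - simpl. replace (0 + z)%C with z by ring. ring.
  - cbn [Cpochhammer]. rewrite S_INR, RtoC_plus.
    replace (RtoC (INR n) + 1 + z)%C with (RtoC (INR n) + z + 1)%C by ring.
    rewrite Gamma_plus1, IH; [ring|].
    unfold Re in *; simpl. pose proof (pos_INR n). lra.
Qed.

Lemma Re_div2 (z : C) : Re (z / 2) = Re z / 2.
Proof. destruct z; unfold Re; simpl. field. Qed.

Lemma Re_pos_neq_0 (z : C) : 0 < Re z -> z <> 0.
Proof. intros H E. rewrite E in H. unfold Re in H; simpl in H. lra. Qed.

Lemma Cpochhammer_neq_0 (z : C) (n : nat) : 0 < Re z -> Cpochhammer z n <> 0.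
Proof.
  intros Hz. induction n as [|n IH].
  - simpl. apply C1_nz.
  - simpl. apply Cmult_neq_0; [assumption|]. apply Re_pos_neq_0.
    unfold Re in *; simpl. pose proof (pos_INR n). lra.
Qed.

(** Consecutive factors are paired: (2k + z)(2k + 1 + z) = 4 (k + z/2)(k + (z+1)/2). *)
Lemma Cpochhammer_double (z : C) (n : nat) :
  Cpochhammer z (2 * n) =
    (RtoC (4 ^ n) * Cpochhammer (z / 2) n * Cpochhammer ((z + 1) / 2) n)%C.
Proof.
  induction n as [|n IH].
  - simpl. ring.
  - replace (2 * S n)%nat with (S (S (2 * n))) by lia.
    set (k := (2 * n)%nat) in *. cbn [Cpochhammer]. rewrite IH. cbn [pow]. unfold k.
    rewrite S_INR, mult_INR, !RtoC_plus, !RtoC_mult. change (INR 2) with 2.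
    field.
Qed.

Lemma Cmult_cancel_l (c a b : C) : c <> 0 -> (c * a = c * b)%C -> a = b.
Proof.
  intros Hc H. transitivity (/ c * (c * a))%C; [field; assumption|].
  rewrite H. field. assumption.
Qed.

(** A_n(w) with n = m + 3, cleared of its denominator and with the shift by n removed by the
    functional equation. *)
Lemma Gamma_ratio_mult (w : C) (m : nat) : 0 < Re w ->
  (Gamma_ratio w m * (cpow_pos (INR m + 3) w * RtoC (INR (fact (m + 2)))))%C =
    (Cpochhammer w (m + 3) * Gamma w)%C.
Proof.
  intros Hw. rewrite <- Gamma_INR_plus by assumption.
  rewrite plus_INR. replace (INR 3) with 3 by (simpl; ring). unfold Gamma_ratio. field.
  split; [apply RtoC_fact_neq_0|apply cpow_pos_neq_0].
Qed.

(** [Gamma_ratio_mult] is applied at z/2, (z+1)/2 and z. The Pochhammer products cancel by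
    [Cpochhammer_double], and the remaining powers and factorials assemble into 2^(z-1) and
    kappa_n. *)
Lemma duplication_ratio (z : C) (m : nat) : 0 < Re z ->
  (cpow_pos 2 (z - 1) * Gamma (z / 2) * Gamma ((z + 1) / 2) * Gamma_ratio z (2 * m + 3))%C =
  (Gamma_ratio (z / 2) m * Gamma_ratio ((z + 1) / 2) m * RtoC (wallis_const m) * Gamma z)%C.
Proof.
  intros Hz.
  assert (Hz1 : 0 < Re (z / 2)).
  { rewrite Re_div2. lra. }
  assert (Hz2 : 0 < Re ((z + 1) / 2)).
  { rewrite Re_div2. unfold Re in *; simpl. lra. }
  pose proof (Gamma_ratio_mult (z / 2) m Hz1) as E1.
  pose proof (Gamma_ratio_mult ((z + 1) / 2) m Hz2) as E2.
  pose proof (Gamma_ratio_mult z (2 * m + 3) Hz) as E3.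
  (* The index of [Gamma_ratio] is its parameter minus 3, so index [2 * m + 3] carries twice the
     parameter of index [m]. *)
  replace (2 * m + 3 + 3)%nat with (2 * (m + 3))%nat in E3 by lia.
  rewrite Cpochhammer_double in E3.
  replace (2 * m + 3 + 2)%nat with (2 * m + 5)%nat in E3 by lia.
  assert (Hm : 0 <= INR m) by apply pos_INR.
  set (s := INR m + 3) in *. assert (Hs : 0 < s) by (unfold s; lra).
  replace (INR (2 * m + 3) + 3) with (2 * s) in E3
    by (unfold s; rewrite plus_INR, mult_INR; simpl; ring).
  rewrite cpow_pos_mult in E3 by lra.
  replace (cpow_pos 2 z) with (cpow_pos 2 (z - 1) * RtoC 2)%C in E3.
  2: { rewrite <- (cpow_pos_1 2) by lra. rewrite <- cpow_pos_plus. f_equal. ring. }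
  (* The exponents add up to z + 1/2; the excess 1/2 is the square root in kappa_n. *)
  assert (Es : (cpow_pos s (z / 2) * cpow_pos s ((z + 1) / 2) = cpow_pos s z * RtoC (sqrt s))%C).
  { replace (sqrt s) with (exp (/ 2 * ln s)) by (symmetry; exact (eq_sym (Rpower_sqrt s Hs))).
    rewrite <- cpow_pos_R, <- !cpow_pos_plus. f_equal.
    rewrite RtoC_inv by lra. field. }
  unfold wallis_const. fold s.
  set (F := INR (fact (m + 2))) in *.
  pose proof (RtoC_fact_neq_0 (2 * m + 5)) as HF5.
  pose proof (INR_fact_neq_0 (2 * m + 5)) as HF5'.
  set (F5 := INR (fact (2 * m + 5))) in *.
  pose proof (Cpochhammer_neq_0 _ (m + 3) Hz1) as Hc1.
  pose proof (Cpochhammer_neq_0 _ (m + 3) Hz2) as Hc2.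
  set (c1 := Cpochhammer (z / 2) (m + 3)) in *.
  set (c2 := Cpochhammer ((z + 1) / 2) (m + 3)) in *.
  set (A1 := Gamma_ratio (z / 2) m) in *. set (A2 := Gamma_ratio ((z + 1) / 2) m) in *.
  set (A3 := Gamma_ratio z (2 * m + 3)) in *.
  set (G1 := Gamma (z / 2)) in *. set (G2 := Gamma ((z + 1) / 2)) in *. set (G := Gamma z) in *.
  set (p := cpow_pos 2 (z - 1)) in *.
  pose proof (cpow_pos_neq_0 s z) as Hp.
  set (q := cpow_pos s z) in *. set (q1 := cpow_pos s (z / 2)) in *.
  set (q2 := cpow_pos s ((z + 1) / 2)) in *.
  rewrite RtoC_div by (apply Rmult_integral_contrapositive_currified; [lra|assumption]).
  rewrite !RtoC_mult, !RtoC_pow in *.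
  set (f := (RtoC 4 ^ (m + 3))%C) in *.
  assert (M : (c1 * c2 * (G1 * G2) * (A3 * p * RtoC 2 * q * RtoC F5) =
    A1 * A2 * q * RtoC (sqrt s) * RtoC F * RtoC F * (f * c1 * c2 * G))%C).
  { transitivity ((c1 * G1) * (c2 * G2) * (A3 * (p * RtoC 2 * q * RtoC F5)))%C; [ring|].
    rewrite <- E1, <- E2, E3.
    transitivity (A1 * A2 * (q1 * q2) * RtoC F * RtoC F * (f * c1 * c2 * G))%C; [ring|].
    rewrite Es. ring. }
  apply (Cmult_cancel_l (c1 * c2 * (RtoC 2 * q * RtoC F5))%C).
  { repeat apply Cmult_neq_0; try assumption. intros H. apply RtoC_inj in H. lra. }
  transitivity (c1 * c2 * (G1 * G2) * (A3 * p * RtoC 2 * q * RtoC F5))%C; [ring|].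
  rewrite M. field. assumption.
Qed.

(** Passage to the limit in [duplication_ratio]: |X - Y| is independent of [m] and bounded by a
    sequence tending to 0. *)
Lemma Gamma_duplication (z : C) : 0 < Re z ->
  (cpow_pos 2 (z - 1) * Gamma (z / 2) * Gamma ((z + 1) / 2) = RtoC (sqrt PI) * Gamma z)%C.
Proof.
  intros Hz.
  assert (Hz1 : 0 <= Re (z / 2)).
  { rewrite Re_div2. lra. }
  assert (Hz2 : 0 <= Re ((z + 1) / 2)).
  { rewrite Re_div2. unfold Re in *; simpl. lra. }
  set (X := (cpow_pos 2 (z - 1) * Gamma (z / 2) * Gamma ((z + 1) / 2))%C).
  set (Y := (RtoC (sqrt PI) * Gamma z)%C).
  pose proof (Cmod_mult_sub1_lim _ _ (Gamma_ratio_lim _ Hz1) (Gamma_ratio_lim _ Hz2)) as L12.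
  assert (L3 : is_lim_seq (fun m => Cmod (Gamma_ratio z (2 * m + 3) - 1)) 0).
  { apply (is_lim_seq_subseq (fun m => Cmod (Gamma_ratio z m - 1)) 0 (fun m => 2 * m + 3)%nat).
    - apply eventually_subseq. intros n. lia.
    - apply Gamma_ratio_lim. lra. }
  pose proof wallis_const_lim as LW.
  assert (LW0 : is_lim_seq (fun m => Rabs (wallis_const m - sqrt PI)) 0).
  { pose proof (is_lim_seq_minus' _ _ _ _ LW (is_lim_seq_const (sqrt PI))) as H.
    apply is_lim_seq_abs in H. simpl in H. rewrite Rminus_diag, Rabs_R0 in H. exact H. }
  pose proof (is_lim_seq_plus' _ _ _ _
    (is_lim_seq_mult' _ _ _ _ (is_lim_seq_const (Cmod X)) L3)
    (is_lim_seq_plus' _ _ _ _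
      (is_lim_seq_mult' _ _ _ _ L12 (is_lim_seq_mult' _ _ _ _
         (is_lim_seq_plus' _ _ _ _ LW0 (is_lim_seq_const (sqrt PI))) (is_lim_seq_const (Cmod (Gamma z)))))
      (is_lim_seq_mult' _ _ _ _ LW0 (is_lim_seq_const (Cmod (Gamma z)))))) as L.
  replace (Cmod X * 0 + (0 * ((0 + sqrt PI) * Cmod (Gamma z)) + 0 * Cmod (Gamma z))) with 0 in L by ring.
  assert (B : Rbar_le (Cmod (X - Y)%C) 0).
  { refine (is_lim_seq_le (fun _ => Cmod (X - Y)%C) _ _ _ _ (is_lim_seq_const _) L).
    intros m. cbv beta.
    pose proof (duplication_ratio z m Hz) as E. fold X in E.
    set (A12 := (Gamma_ratio (z / 2) m * Gamma_ratio ((z + 1) / 2) m)%C) in *.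
    set (A3 := Gamma_ratio z (2 * m + 3)) in *. set (k := wallis_const m) in *.
    (* By [E], [X * A3 = A12 * k * Gamma z]; this decomposition puts into each term a factor that
       tends to 0. *)
    replace (X - Y)%C with (- (X * (A3 - 1)) + ((A12 - 1) * (RtoC k * Gamma z) + RtoC (k - sqrt PI) * Gamma z))%C.
    2: { rewrite RtoC_minus. unfold Y.
      transitivity (X - X * A3 + A12 * RtoC k * Gamma z - RtoC (sqrt PI) * Gamma z)%C; [ring|].
      rewrite E. ring. }
    eapply Rle_trans; [apply Cmod_triangle|]. rewrite Cmod_opp, Cmod_mult.
    apply Rplus_le_compat_l.
    eapply Rle_trans; [apply Cmod_triangle|]. rewrite !Cmod_mult, !Cmod_R.
    apply Rplus_le_compat_r. apply Rmult_le_compat_l; [apply Cmod_ge_0|].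
    apply Rmult_le_compat_r; [apply Cmod_ge_0|].
    replace k with ((k - sqrt PI) + sqrt PI) at 1 by ring.
    eapply Rle_trans; [apply Rabs_triang|]. rewrite (Rabs_pos_eq (sqrt PI)); [lra|apply sqrt_pos]. }
  simpl in B. pose proof (Cmod_ge_0 (X - Y)).
  assert (Z : (X - Y = 0)%C) by (apply Cmod_eq_0; lra).
  transitivity (X - Y + Y)%C; [ring|]. rewrite Z. ring.
Qed.

(** * Bessel polynomial coefficients and the recurrence of the sums *)

Lemma pochhammer_S_l (a : R) (k : nat) : pochhammer a (S k) = a * pochhammer (a + 1) k.
Proof.
  induction k as [|k IH].
  - simpl. ring.
  - change (pochhammer a (S (S k))) with (pochhammer a (S k) * (a + INR (S k))).
    rewrite IH, S_INR. simpl pochhammer. ring.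
Qed.

Lemma pochhammer_eq_0 (a : R) (i k : nat) : (i < k)%nat -> a + INR i = 0 -> pochhammer a k = 0.
Proof.
  intros H E. induction H; simpl.
  - rewrite E. ring.
  - rewrite IHle. ring.
Qed.

(* Vanishes at x = m < n, so that sums for different m can be taken over the same range. *)
Definition bessel_coef (x : R) (n : nat) : R :=
  pochhammer (x - INR n + 1) (2 * n) / (2 ^ n * INR (fact n)).

Lemma bessel_coef_0 (x : R) : bessel_coef x 0 = 1.
Proof. unfold bessel_coef. simpl. field. Qed.

Lemma bessel_coef_gt (m n : nat) : (m < n)%nat -> bessel_coef (INR m) n = 0.
Proof.
  intros H. unfold bessel_coef.
  rewrite (pochhammer_eq_0 _ (n - m - 1)); [unfold Rdiv; ring|lia|].
  rewrite !minus_INR by lia. simpl. ring.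
Qed.

(** All three Pochhammer symbols share the factor [P], and what is left is (x+n+2)(x+n+3) -
    (x-n)(x-n+1) = 2(n+1)(2x+3). *)
Lemma bessel_coef_rec (x : R) (n : nat) :
  bessel_coef (x + 2) (S n) = bessel_coef x (S n) + (2 * x + 3) * bessel_coef (x + 1) n.
Proof.
  unfold bessel_coef. replace (2 * S n)%nat with (S (S (2 * n))) by lia.
  set (k := (2 * n)%nat). assert (Ek : INR k = 2 * INR n) by (unfold k; rewrite mult_INR; simpl; ring).
  change (pochhammer (x + 2 - INR (S n) + 1) (S (S k))) with
    (pochhammer (x + 2 - INR (S n) + 1) k * (x + 2 - INR (S n) + 1 + INR k)
       * (x + 2 - INR (S n) + 1 + INR (S k))).
  rewrite !pochhammer_S_l, !S_INR, Ek.
  replace (x + 2 - (INR n + 1) + 1) with (x + 1 - INR n + 1) by ring.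
  replace (x - (INR n + 1) + 1 + 1 + 1) with (x + 1 - INR n + 1) by ring.
  set (P := pochhammer (x + 1 - INR n + 1) k).
  rewrite fact_simpl, mult_INR, S_INR. simpl pow.
  pose proof (pos_INR n). pose proof (INR_fact_neq_0 n).
  assert (2 ^ n <> 0) by (apply pow_nonzero; lra).
  field. repeat split; try assumption; lra.
Qed.

Definition bessel_sum (x : R) (z : C) (N : nat) : C :=
  sum_n (fun n => Gamma (z - RtoC (INR n)) * RtoC (bessel_coef x n))%C N.

Lemma bessel_sum_S (x : R) (z : C) (N : nat) :
  bessel_sum x z (S N) =
    (bessel_sum x z N + Gamma (z - RtoC (INR (S N))) * RtoC (bessel_coef x (S N)))%C.
Proof. unfold bessel_sum. rewrite sum_Sn. reflexivity. Qed.

Lemma bessel_sum_0 (x : R) (z : C) : bessel_sum x z 0 = Gamma z.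
Proof.
  unfold bessel_sum. rewrite sum_O, bessel_coef_0. simpl.
  replace (z - 0)%C with z by ring. ring.
Qed.

(** Coefficient by coefficient: as z - 1 - n = z - (n+1), the last sum contributes to the term of
    index n + 1. *)
Lemma bessel_sum_rec (x : R) (z : C) (N : nat) :
  bessel_sum (x + 2) z (S N) =
    (bessel_sum x z (S N) + RtoC (2 * x + 3) * bessel_sum (x + 1) (z - 1) N)%C.
Proof.
  induction N as [|N IH].
  - rewrite !bessel_sum_S, !bessel_sum_0, bessel_coef_rec, bessel_coef_0.
    rewrite Rmult_1_r, !RtoC_plus. simpl (INR 1). ring.
  - rewrite (bessel_sum_S (x + 2)), IH, (bessel_sum_S x z (S N)), (bessel_sum_S (x + 1)).
    rewrite bessel_coef_rec, (RtoC_plus (bessel_coef _ _)), RtoC_mult.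
    replace (z - 1 - RtoC (INR (S N)))%C with (z - RtoC (INR (S (S N))))%C
      by (rewrite (S_INR (S N)), RtoC_plus; ring).
    ring.
Qed.

(** * The product of Gamma values and the final induction *)

(** For Re z > m this is sqrt(2/PI) times the Mellin transform, at z + 1/2, of the modified Bessel
    function K of order m + 1/2. *)
Definition bessel_mellin (m : nat) (z : C) : C :=
  ((cpow_pos 2 (z - 1) / RtoC (sqrt PI)) * Gamma ((z + RtoC (INR m) + 1) / 2)
     * Gamma ((z - RtoC (INR m)) / 2))%C.

Lemma RtoC_sqrt_PI_neq_0 : RtoC (sqrt PI) <> 0.
Proof.
  intros H. apply RtoC_inj in H. pose proof (sqrt_lt_R0 PI PI_RGT_0). lra.
Qed.

Lemma bessel_mellin_0 (z : C) : 0 < Re z -> bessel_mellin 0 z = Gamma z.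
Proof.
  intros Hz. pose proof (Gamma_duplication z Hz) as H. unfold bessel_mellin. simpl (INR 0).
  replace (z + 0 + 1)%C with (z + 1)%C by ring. replace (z - 0)%C with z by ring.
  pose proof RtoC_sqrt_PI_neq_0 as Hp.
  apply (Cmult_cancel_l (RtoC (sqrt PI))); [assumption|]. rewrite <- H. field; assumption.
Qed.

(* The gamma factors of the three terms are Gamma(a+1) Gamma(b), Gamma(a) Gamma(b+1)
   and Gamma(a) Gamma(b), with a = (z+m+1)/2, b = (z-m-2)/2 and a - b = (2m+3)/2. *)
Lemma bessel_mellin_rec (m : nat) (z : C) : INR m + 2 < Re z ->
  bessel_mellin (S (S m)) z =
    (bessel_mellin m z + RtoC (2 * INR m + 3) * bessel_mellin (S m) (z - 1))%C.
Proof.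
  intros Hz. pose proof (pos_INR m) as Hm.
  unfold bessel_mellin. rewrite !S_INR, !RtoC_plus, RtoC_mult.
  set (a := ((z + RtoC (INR m) + 1) / 2)%C). set (b := ((z - RtoC (INR m) - 2) / 2)%C).
  assert (Ha : 0 < Re a).
  { unfold a. rewrite Re_div2. unfold Re in *; simpl. lra. }
  assert (Hb : 0 < Re b).
  { unfold b. rewrite Re_div2. unfold Re in *; simpl. lra. }
  replace ((z + (RtoC (INR m) + 1 + 1) + 1) / 2)%C with (a + 1)%C by (unfold a; field).
  replace ((z - (RtoC (INR m) + 1 + 1)) / 2)%C with b
    by (unfold b; f_equal; ring).
  replace ((z - RtoC (INR m)) / 2)%C with (b + 1)%C by (unfold b; field).
  replace ((z - 1 + (RtoC (INR m) + 1) + 1) / 2)%C with a by (unfold a; f_equal; ring).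
  replace ((z - 1 - (RtoC (INR m) + 1)) / 2)%C with b
    by (unfold b; f_equal; ring).
  rewrite !Gamma_plus1 by assumption.
  replace (cpow_pos 2 (z - 1))%C with (cpow_pos 2 (z - 1 - 1) * RtoC 2)%C.
  2: { rewrite <- (cpow_pos_1 2) by lra. rewrite <- cpow_pos_plus. f_equal. ring. }
  replace (RtoC 2 * RtoC (INR m) + RtoC 3)%C with (RtoC 2 * (a - b))%C.
  2: { unfold a, b. field. }
  field. apply RtoC_sqrt_PI_neq_0.
Qed.

(** Duplication writes both terms on the right as products of Gamma values at [a], [b] or [b + 1],
    and the claim becomes a = b + 1/2. *)
Lemma bessel_mellin_1 (z : C) : 1 < Re z ->
  bessel_mellin 1 z = (Gamma z + Gamma (z - 1))%C.
Proof.
  intros Hz.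
  rewrite <- (bessel_mellin_0 z), <- (bessel_mellin_0 (z - 1)) by (unfold Re in *; simpl; lra).
  unfold bessel_mellin. simpl (INR 1). simpl (INR 0).
  set (a := (z / 2)%C). set (b := ((z - 1) / 2)%C).
  assert (Ha : 0 < Re a).
  { unfold a. rewrite Re_div2. unfold Re in *; simpl. lra. }
  assert (Hb : 0 < Re b).
  { unfold b. rewrite Re_div2. unfold Re in *; simpl. lra. }
  replace ((z + 1 + 1) / 2)%C with (a + 1)%C
    by (unfold a; field).
  replace ((z + 0 + 1) / 2)%C with (b + 1)%C
    by (unfold b; field).
  replace ((z - 0) / 2)%C with a by (unfold a; f_equal; ring).
  replace ((z - 1 + 0 + 1) / 2)%C with a by (unfold a; f_equal; ring).
  replace ((z - 1 - 0) / 2)%C with b by (unfold b; f_equal; ring).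
  rewrite !Gamma_plus1 by assumption.
  replace (cpow_pos 2 (z - 1))%C with (cpow_pos 2 (z - 1 - 1) * RtoC 2)%C.
  2: { rewrite <- (cpow_pos_1 2) by lra. rewrite <- cpow_pos_plus. f_equal. ring. }
  (* Only the bare factors are opened; [Gamma a] and [Gamma b] stay atoms for [field]. *)
  unfold a at 1. unfold b at 2.
  field. apply RtoC_sqrt_PI_neq_0.
Qed.

Lemma bessel_mellin_sum (m : nat) : forall z : C, INR m < Re z ->
  bessel_mellin m z = bessel_sum (INR m) z m.
Proof.
  (* The recurrence spans two steps, so the induction carries [m] and [m + 1] together. *)
  assert (H : forall m, (forall z : C, INR m < Re z -> bessel_mellin m z = bessel_sum (INR m) z m) /\
    (forall z : C, INR (S m) < Re z -> bessel_mellin (S m) z = bessel_sum (INR (S m)) z (S m)));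
    [|apply H].
  clear m. induction m as [|m [IH1 IH2]].
  - split; intros z Hz.
    + rewrite bessel_mellin_0, bessel_sum_0; trivial.
    + rewrite bessel_mellin_1, bessel_sum_S, bessel_sum_0 by assumption.
      replace (bessel_coef (INR 1) 1) with 1 by (unfold bessel_coef; simpl; field).
      simpl (INR 1). ring.
  - split; [assumption|]. intros z Hz. rewrite !S_INR in Hz.
    rewrite bessel_mellin_rec by lra.
    rewrite IH1, IH2 by (rewrite ?S_INR; unfold Re in *; simpl; lra).
    rewrite !S_INR. replace (INR m + 1 + 1) with (INR m + 2) by ring.
    (* The recurrence runs the sum for [m] up to m + 2; its terms of index m + 1 and m + 2
       vanish. *)
    rewrite bessel_sum_rec, !bessel_sum_S, !bessel_coef_gt by lia. ring.
Qed.

Theorem mainTheorem1 (m : nat) (z : C) (hz : INR m < Re z) :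
  ((cpow_pos 2 (z - 1) / RtoC (sqrt PI))
     * Gamma ((z + RtoC (INR m) + 1) / 2)
     * Gamma ((z - RtoC (INR m)) / 2))%C
  = sum_n (fun n : nat =>
       (Gamma (z - RtoC (INR n))
        / RtoC (2 ^ n * INR (Factorial.fact n))
        * RtoC (pochhammer (INR m - INR n + 1) (2 * n)))%C) m.
Proof.
  change (bessel_mellin m z = sum_n (fun n : nat =>
       (Gamma (z - RtoC (INR n))
        / RtoC (2 ^ n * INR (Factorial.fact n))
        * RtoC (pochhammer (INR m - INR n + 1) (2 * n)))%C) m).
  rewrite bessel_mellin_sum by assumption. unfold bessel_sum. apply sum_n_ext. intros n.
  assert (H : 2 ^ n * INR (fact n) <> 0).
  { apply Rmult_integral_contrapositive_currified;
      [apply pow_nonzero; lra|apply INR_fact_neq_0]. }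
  unfold bessel_coef. rewrite RtoC_div by assumption.
  (* Restates the equality at type [C], where [field] recognises it. *)
  match goal with |- ?a = ?b => change (@eq C a b) end. field.
  intros K. apply H, RtoC_inj, K.
Qed.
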